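(* Let $p$ be an odd prime and $a\in\mathbb{F}_p$ with $a\neq 0,1,\tfrac12$. Let $n_a$ be the number of primes of $\mathcal{R}^{(2)}$ lying above $(t-a)$. Then: $n_a=8$ if $A_2(a)=1$; $n_a=4$ if $A_2(a)=-1$, or $A_2(a)=0$, or $A_2(a)^2=\frac{1}{1-a}$; and $n_a=2$ if $A_2(a)^2=\frac{a}{1-a}$.
   Context: Let $t$ be transcendental over $\mathbb{F}_p$. Let $\mathcal{K}^{(2)}=\mathbb{F}_p(t)(\sqrt{t},\sqrt{1-t})$ and $\mathcal{R}^{(2)}=\mathcal{K}^{(2)}(\sqrt{1+\sqrt{t}})$ (here $\epsilon_2(t)=1-\zeta_2\sqrt t=1+\sqrt t$); this is a Galois extension of $\mathbb{F}_p(t)$ of degree $8$ with group isomorphic to the group of upper unitriangular $3\times3$ matrices over $\mathbb{F}_2$, unramified outside $\{0,1,\infty\}$. Primes above $(t-a)$ mean primes of the integral closure of $\mathbb{F}_p[t]$ in $\mathcal{R}^{(2)}$. Define $A_2(x)=\frac12\left((1-\sqrt{x})^{(p-1)/2}+(1+\sqrt{x})^{(p-1)/2}\right)$, which is invariant under $\sqrt x\mapsto-\sqrt x$ and hence a polynomial in $x$ over $\mathbb{F}_p$. *)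

(* Defs.v *)
From HB Require Import structures.
From mathcomp Require Import all_boot all_order all_algebra all_field.
From mathcomp Require Import boolp classical_sets functions cardinality.

Set Implicit Arguments.
Unset Strict Implicit.
Unset Printing Implicit Defensive.
Import GRing.Theory.

Local Open Scope ring_scope.

Definition prime_ideal (R : comNzRingType) (P : set R) : Prop :=
  idealr_closed [in P] /\ prime_idealr_closed [in P].

Section IntegralClosure.
Variables (A : comNzRingType) (K : fieldType) (iota : {rmorphism A -> K}).

Definition integral_over_pred : {pred K} := fun x => `[< integralOver iota x >].

Fact integral_over_subring : subring_closed integral_over_pred.
Proof.
split=> [|x y|x y]; rewrite !unfold_in.
- by apply/asboolP; apply: integral1.
- by move=> /asboolP ix /asboolP iy; apply/asboolP; apply: integral_sub.
- by move=> /asboolP ix /asboolP iy; apply/asboolP; apply: integral_mul.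
Qed.

HB.instance Definition _ :=
  GRing.isSubringClosed.Build K integral_over_pred integral_over_subring.

Record int_closure := IntClosure {
  int_closure_val :> K;
  _ : int_closure_val \in integral_over_pred
}.

HB.instance Definition _ := [isSub for int_closure_val].
HB.instance Definition _ := [Choice of int_closure by <:].
HB.instance Definition _ :=
  [SubChoice_isSubComNzRing of int_closure by <:].

Fact int_closure_in_subproof (x : A) : iota x \in integral_over_pred.
Proof. by apply/asboolP; apply: integral_id. Qed.

Definition int_closure_in (x : A) : int_closure :=
  IntClosure (int_closure_in_subproof x).

(* The primes P of the integral closure whose contraction to A is the
   principal ideal generated by pi. *)
Definition primes_above (pi : A) : set (set int_closure) :=
  [set P | prime_ideal P /\
    forall x : A, P (int_closure_in x) <-> exists y : A, x = y * pi]%classic.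

End IntegralClosure.

Arguments int_closure_in {A K} iota x.
Arguments primes_above {A K} iota pi.

Notation "''F_' p '(t)'" := {fraction {poly 'F_p}}
  (at level 0, p at level 2, format "''F_' p '(t)'") : type_scope.

Section R2.
Variables (p : nat) (L : fieldExtType 'F_p(t)).

Definition poly_in : {rmorphism {poly 'F_p} -> L} :=
  in_alg L \o @tofrac {poly 'F_p}.

(* L is R^(2), with s = sqrt t, u = sqrt (1 - t) and w = sqrt (1 + sqrt t);
   <<1; s; u>> is the subfield K^(2). *)
Definition is_R2 (s u w : L) : Prop :=
  [/\ s ^+ 2 = poly_in 'X,
      u ^+ 2 = 1 - poly_in 'X,
      w ^+ 2 = 1 + s
    & <<<<<<1; s>>; u>>; w>>%VS = fullv].

End R2.

(* A_2 evaluated at x = y ^ 2, as a polynomial in y. *)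
Definition A2_sqrt (p : nat) : {poly 'F_p} :=
  2%:R^-1 *: ((1 - 'X) ^+ (p.-1)./2 + (1 + 'X) ^+ (p.-1)./2).

Definition A2 (p : nat) : {poly 'F_p} := even_poly (A2_sqrt p).

Lemma A2E (p : nat) : A2 p \Po 'X^2 = A2_sqrt p.
Proof.
suff odd0: odd_poly (A2_sqrt p) = 0.
  by rewrite -[RHS]poly_even_odd odd0 comp_poly0 mul0r addr0.
apply/polyP=> i; rewrite coef0 coef_odd_poly /A2_sqrt coefZ coefD.
set m := (p.-1)./2.
have coef1X (c : 'F_p) : ((1 + c *: 'X) ^+ m)`_i.*2.+1 =
    c ^+ i.*2.+1 *+ 'C(m, i.*2.+1).
  rewrite exprDn coef_sum.
  under eq_bigr do rewrite expr1n mul1r coefMn exprZn coefZ coefXn.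
  have [le_m|lt_m] := ltnP m i.*2.+1.
    rewrite bin_small // mulr0n big1 // => k _.
    by rewrite gtn_eqF ?mulr0 ?mul0rn //; exact: leq_trans (ltn_ord k) le_m.
  rewrite (bigD1 (Ordinal (lt_m : i.*2.+1 < m.+1)%N)) //= eqxx mulr1 big1 ?addr0 //.
  move=> k; rewrite -val_eqE /= eq_sym => /negPf ->.
  by rewrite mulr0 mul0rn.
have := coef1X (-1); rewrite scaleN1r => ->.
have := coef1X 1; rewrite scale1r => ->.
by rewrite expr1n -signr_odd /= odd_double expr1 mulNrn addNr mulr0.
Qed.

(* Main.v *)
(** The residue fields above (t - a) embed in the field F with p^4 elements.  Since
    t, 1 - t and 2 are units at t = a, every solution (b, c, d) in F of
    b^2 = a, c^2 = 1 - a, d^2 = 1 + b yields a homomorphism from the integral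
    closure to F with t |-> a, s |-> b, u |-> c, w |-> d.  It is built one square
    root y at a time: if x is integral with conjugate x', then x + x' and
    y (x - x') are integral in the smaller field and
    phi x = (phi (x + x') + phi (y (x - x')) / phi y) / 2.
    The primes above (t - a) are the kernels of these 8 homomorphisms, and two
    kernels agree iff the homomorphisms are conjugate under Frobenius, so there
    are 8 / f primes if Frobenius acts on the 8 points with orbits of size f.
    As b^p = +-b, c^p = +-c and d^(p-1) = (1 + b)^((p-1)/2), the value A_2(a) is
    half the sum of the two powers (1 +- b)^((p-1)/2), which determines f. *)

Require Import Defs.
From HB Require Import structures.
From mathcomp Require Import all_boot all_order all_algebra all_field.
From mathcomp Require Import fingroup cyclic.
From mathcomp Require Import boolp classical_sets functions cardinality.
From mathcomp Require Import ring zify.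

Set Implicit Arguments.
Unset Strict Implicit.
Unset Printing Implicit Defensive.
Import GRing.Theory.

Local Open Scope ring_scope.
Local Open Scope card_scope.

Local Ltac mem_sub :=
  repeat first [assumption | exact: rpred_nat | exact: rpred0 | exact: rpred1
    | apply: rpredB | apply: rpredD | apply: rpredM].

Local Ltac int_sub :=
  repeat first [assumption | exact: integral_nat | apply: integral_sub
    | apply: integral_add | apply: integral_mul].

(** * Homomorphisms on integral elements and quadratic extensions *)

Section QuadraticStep.
Variables (A : comNzRingType) (K : fieldType) (L : fieldExtType K).
Variables (iota : {rmorphism A -> L}) (F : fieldType) (theta : {rmorphism A -> F}).

(* Only the restriction of [phi] to the elements of [E] integral over [A]
   matters; its other values are junk. *)
Definition place_hom (E : {vspace L}) (phi : L -> F) : Prop :=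
  [/\ forall f, phi (iota f) = theta f,
      forall x y, x \in E -> y \in E -> integralOver iota x ->
        integralOver iota y -> phi (x + y) = phi x + phi y
    & forall x y, x \in E -> y \in E -> integralOver iota x ->
        integralOver iota y -> phi (x * y) = phi x * phi y].

Variables (E : {subfield L}) (y : L).
Hypotheses (iotaE : forall f, iota f \in E) (two_neq0 : 2%:R != 0 :> F).
Hypotheses (y_notin : y \notin E) (y2_in : y ^+ 2 \in E).
Hypothesis y_int : integralOver iota y.

Lemma quad_coords x : x \in <<E; y>>%VS ->
  exists c, [/\ c.1 \in E, c.2 \in E & x = c.1 + c.2 * y].
Proof.
case/Fadjoin_polyP=> q qE ->; elim/poly_ind: q qE => [|q c IH] qcE.
  by exists (0, 0); rewrite !rpred0 horner0 mul0r addr0.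
have cE: c \in E by have /polyOverP/(_ 0%N) := qcE; rewrite coefD coefMX coefC /= add0r.
have qE: q \is a polyOver E.
  apply/polyOverP=> i; have /polyOverP/(_ i.+1) := qcE.
  by rewrite coefD coefMX coefC /= addr0.
have [[u v] [/= uE vE qy]] := IH qE.
exists (v * y ^+ 2 + c, u); split=> //=; first by mem_sub.
by rewrite hornerD hornerM hornerX hornerC qy; ring.
Qed.

Lemma quad_uniq_coords u v u' v' : u \in E -> v \in E -> u' \in E -> v' \in E ->
  u + v * y = u' + v' * y -> u = u' /\ v = v'.
Proof.
move=> uE vE u'E v'E e.
suff ev: v = v' by split=> //; move: e; rewrite ev => /addIr.
apply/eqP; apply: contraNT y_notin => nvv.
have nz: v - v' != 0 by rewrite subr_eq0.
have -> : y = (u' - u) / (v - v').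
  apply: (mulIf nz); rewrite divfK //; apply/eqP; rewrite -subr_eq0; apply/eqP.
  have -> : y * (v - v') - (u' - u) = (u + v * y) - (u' + v' * y) by ring.
  by rewrite e subrr.
by rewrite rpred_div ?rpredB.
Qed.

Lemma quad_conj_horner (u v : L) (q : {poly L}) : u \in E -> v \in E ->
    q \is a polyOver E ->
  exists c, [/\ c.1 \in E, c.2 \in E, q.[u + v * y] = c.1 + c.2 * y
              & q.[u - v * y] = c.1 - c.2 * y].
Proof.
move=> uE vE; elim/poly_ind: q => [|q c IH] qcE.
  by exists (0, 0); rewrite /= !rpred0 !horner0 mul0r addr0 subr0.
have cE: c \in E by have /polyOverP/(_ 0%N) := qcE; rewrite coefD coefMX coefC /= add0r.
have qE: q \is a polyOver E.
  apply/polyOverP=> i; have /polyOverP/(_ i.+1) := qcE.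
  by rewrite coefD coefMX coefC /= addr0.
have [[a b] [/= aE bE q1 q2]] := IH qE.
exists (a * u + b * v * y ^+ 2 + c, a * v + b * u); split=> /=.
- by mem_sub.
- by mem_sub.
- by rewrite hornerD hornerM hornerX hornerC q1; ring.
- by rewrite hornerD hornerM hornerX hornerC q2; ring.
Qed.

Lemma quad_conj_integral u v : u \in E -> v \in E ->
  integralOver iota (u + v * y) -> integralOver iota (u - v * y).
Proof.
move=> uE vE [q q_mon /rootP q0]; exists q => //; apply/rootP.
have qE : map_poly iota q \is a polyOver E.
  by apply/polyOverP=> i; rewrite coef_map; apply: iotaE.
have [[a b] [/= aE bE q1 ->]] := quad_conj_horner uE vE qE.
have [|-> ->] := quad_uniq_coords aE bE (rpred0 E) (rpred0 E).
  by rewrite -q1 q0 mul0r addr0.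
by rewrite mul0r subr0.
Qed.

Lemma quad_coords_integral u v : u \in E -> v \in E ->
    integralOver iota (u + v * y) ->
  integralOver iota (2%:R * u) /\ integralOver iota (2%:R * v * y ^+ 2).
Proof.
move=> uE vE xI; have xI' := quad_conj_integral uE vE xI.
split.
  have -> : 2%:R * u = (u + v * y) + (u - v * y) by ring.
  exact: integral_add.
have -> : 2%:R * v * y ^+ 2 = ((u + v * y) - (u - v * y)) * y by ring.
by apply: integral_mul => //; apply: integral_sub.
Qed.

Lemma place_hom_ext phi z : place_hom E phi -> z != 0 -> z ^+ 2 = phi (y ^+ 2) ->
  exists psi, [/\ place_hom <<E; y>> psi,
    forall x, x \in E -> integralOver iota x -> psi x = phi x & psi y = z].
Proof.
case=> phi_iota phiD phiM z_neq0 z2.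
have [cf cfP] : exists cf : L -> L * L, forall x, x \in <<E; y>>%VS ->
    [/\ (cf x).1 \in E, (cf x).2 \in E & x = (cf x).1 + (cf x).2 * y].
  have ex x : exists c : L * L, x \in <<E; y>>%VS ->
      [/\ c.1 \in E, c.2 \in E & x = c.1 + c.2 * y].
    case: (boolP (x \in <<E; y>>%VS)) => [/quad_coords [c cP]|_]; first by exists c.
    by exists (0, 0).
  by have [cf cfP] := choice ex; exists cf.
have cfE u v : u \in E -> v \in E -> cf (u + v * y) = (u, v).
  move=> uE vE; have [] := cfP (u + v * y).
    by rewrite rpredD ?rpredM ?memv_adjoin ?(subvP_adjoin y).
  case: (cf _) => a b /= aE bE e.
  by have [-> ->] := quad_uniq_coords uE vE aE bE e.
pose psi x := (phi (2%:R * (cf x).1) + phi (2%:R * (cf x).2 * y ^+ 2) / z) / 2%:R.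
have psiE u v : u \in E -> v \in E -> psi (u + v * y) =
    (phi (2%:R * u) + phi (2%:R * v * y ^+ 2) / z) / 2%:R.
  by move=> uE vE; rewrite /psi cfE.
have phi0 : phi 0 = 0 by rewrite -(rmorph0 iota) phi_iota rmorph0.
have phi2 : phi 2%:R = 2%:R by rewrite -(rmorph_nat iota) phi_iota rmorph_nat.
have I2 : integralOver iota 2%:R by apply: integral_nat.
have E2 : 2%:R \in E by apply: rpred_nat.
have y2I : integralOver iota (y ^+ 2) by apply: integral_mul.
have psi_id u : u \in E -> integralOver iota u -> psi u = phi u.
  move=> uE uI; have := psiE u 0 uE (rpred0 E).
  by rewrite mulr0 !mul0r phi0 mul0r !addr0 phiM // phi2 mulrC mulKf.
exists psi; split=> [|x xE xI|].
- split=> [f|x x' xE x'E xI x'I|x x' xE x'E xI x'I].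
  + have fI: integralOver iota (iota f) by apply: integral_id.
    by rewrite psi_id.
  + have [[u v] [/= uE vE xd]] := quad_coords xE.
    have [[u' v'] [/= u'E v'E xd']] := quad_coords x'E; subst x x'.
    have [Tx Ux] := quad_coords_integral uE vE xI.
    have [Tx' Ux'] := quad_coords_integral u'E v'E x'I.
    have -> : u + v * y + (u' + v' * y) = (u + u') + (v + v') * y by ring.
    rewrite !psiE ?rpredD // mulrDr mulrDr mulrDl.
    by rewrite !phiD //; try (by mem_sub); try (by int_sub); field; rewrite two_neq0.
  + have [[u v] [/= uE vE xd]] := quad_coords xE.
    have [[u' v'] [/= u'E v'E xd']] := quad_coords x'E; subst x x'.
    have [Tx Ux] := quad_coords_integral uE vE xI.
    have [Tx' Ux'] := quad_coords_integral u'E v'E x'I.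
    have xx' : (u + v * y) * (u' + v' * y) =
        (u * u' + v * v' * y ^+ 2) + (u * v' + v * u') * y by ring.
    have [Txx Uxx] : integralOver iota (2%:R * (u * u' + v * v' * y ^+ 2)) /\
        integralOver iota (2%:R * (u * v' + v * u') * y ^+ 2).
      apply: quad_coords_integral; [by mem_sub | by mem_sub | rewrite -xx'].
      exact: integral_mul.
    rewrite xx' !psiE //; do ?by mem_sub.
    have eT : y ^+ 2 * 2%:R * (2%:R * (u * u' + v * v' * y ^+ 2)) =
        y ^+ 2 * ((2%:R * u) * (2%:R * u')) +
        (2%:R * v * y ^+ 2) * (2%:R * v' * y ^+ 2) by ring.
    have eU : 2%:R * (2%:R * (u * v' + v * u') * y ^+ 2) =
        (2%:R * u) * (2%:R * v' * y ^+ 2) + (2%:R * v * y ^+ 2) * (2%:R * u').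
      by ring.
    have phi_eT : z ^+ 2 * 2%:R * phi (2%:R * (u * u' + v * v' * y ^+ 2)) =
        z ^+ 2 * (phi (2%:R * u) * phi (2%:R * u')) +
        phi (2%:R * v * y ^+ 2) * phi (2%:R * v' * y ^+ 2).
      rewrite z2 -phi2 -!phiM; do ?by [mem_sub | int_sub].
      by rewrite eT phiD //; do ?by [mem_sub | int_sub].
    have phi_eU : 2%:R * phi (2%:R * (u * v' + v * u') * y ^+ 2) =
        phi (2%:R * u) * phi (2%:R * v' * y ^+ 2) +
        phi (2%:R * v * y ^+ 2) * phi (2%:R * u').
      rewrite -[X in X * _]phi2 -!phiM; do ?by [mem_sub | int_sub].
      by rewrite eU phiD //; do ?by [mem_sub | int_sub].
    move: phi_eT phi_eU.
    move: (phi _) (phi (_ * (u * v' + _) * _)) (phi (2%:R * u)) (phi (2%:R * u'))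
      (phi (2%:R * v * _)) (phi (2%:R * v' * _)) => T U a a' b b' eT' eU'.
    have -> : T = (a * a' + b * b' / z ^+ 2) / 2%:R.
      have -> : a * a' + b * b' / z ^+ 2 = z ^+ 2 * 2%:R * T / z ^+ 2.
        by rewrite eT'; field.
      by field; rewrite z_neq0 two_neq0.
    have -> : U = (a * b' + b * a') / 2%:R by rewrite -eU' mulrC mulKf.
    by field; rewrite z_neq0 two_neq0.
- exact: psi_id.
- have := psiE 0 1 (rpred0 E) (rpred1 E).
  rewrite mul1r add0r mulr0 phi0 add0r mulr1 phiM // phi2 -z2 => ->.
  by field; rewrite z_neq0 two_neq0.
Qed.

Lemma place_hom_coords phi u v : place_hom <<E; y>> phi -> u \in E -> v \in E ->
    integralOver iota (u + v * y) ->
  2%:R * phi y * phi (u + v * y) =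
    phi (2%:R * u) * phi y + phi (2%:R * v * y ^+ 2).
Proof.
case=> phi_iota phiD phiM uE vE xI; have [T U] := quad_coords_integral uE vE xI.
have subE := subvP_adjoin y; have yE := memv_adjoin E y.
have e : 2%:R * y * (u + v * y) = (2%:R * u) * y + 2%:R * v * y ^+ 2 by ring.
have phi2 : phi 2%:R = 2%:R by rewrite -(rmorph_nat iota) phi_iota rmorph_nat.
have TE : 2%:R * u \in <<E; y>>%VS by apply: subE; mem_sub.
have UE : 2%:R * v * y ^+ 2 \in <<E; y>>%VS by apply: subE; mem_sub.
have xE : u + v * y \in <<E; y>>%VS.
  by apply: rpredD; [|apply: rpredM] => //; apply: subE.
rewrite -phi2 -!phiM; do ?by [mem_sub | int_sub].
by rewrite e phiD //; do ?by [mem_sub | int_sub].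
Qed.

Lemma place_hom_uniq phi psi : place_hom <<E; y>> phi -> place_hom <<E; y>> psi ->
    (forall x, x \in E -> integralOver iota x -> phi x = psi x) ->
    phi y = psi y -> phi y != 0 ->
  forall x, x \in <<E; y>>%VS -> integralOver iota x -> phi x = psi x.
Proof.
move=> phiP psiP eqE eqy nz x xE xI.
have [[u v] [/= uE vE xd]] := quad_coords xE; subst x.
have [T U] := quad_coords_integral uE vE xI.
have nz2 : 2%:R * phi y != 0 by rewrite mulf_neq0.
apply: (mulfI nz2); rewrite (place_hom_coords phiP uE vE xI).
rewrite eqy (place_hom_coords psiP uE vE xI) !eqE //; by mem_sub.
Qed.

Lemma place_hom_separate (P : L -> Prop) :
    (forall x z, integralOver iota x -> integralOver iota z ->
       P x -> P z -> P (x + z)) ->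
    (forall x z, integralOver iota x -> integralOver iota z ->
       P x -> P (x * z)) ->
    (forall x z, integralOver iota x -> integralOver iota z ->
       P (x * z) -> P x \/ P z) ->
    ~ P 2%:R -> ~ P y ->
    (forall phi, place_hom E phi -> exists2 z, z != 0 & z ^+ 2 = phi (y ^+ 2)) ->
    (forall x, x \in E -> integralOver iota x ->
       (forall phi, place_hom E phi -> phi x = 0) -> P x) ->
  forall x, x \in <<E; y>>%VS -> integralOver iota x ->
       (forall phi, place_hom <<E; y>> phi -> phi x = 0) -> P x.
Proof.
move=> PD PM Pprime P2 Py sqr IH x xE xI x0.
have [[u v] [/= uE vE xd]] := quad_coords xE; subst x.
have [T U] := quad_coords_integral uE vE xI.
have TE : 2%:R * u \in E by mem_sub.
have UE : 2%:R * v * y ^+ 2 \in E by mem_sub.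
have TU0 phi : place_hom E phi -> phi (2%:R * u) = 0 /\ phi (2%:R * v * y ^+ 2) = 0.
  move=> phiP; have [z z_neq0 z2] := sqr _ phiP.
  have [psi [psiP psi_phi psiy]] := place_hom_ext phiP z_neq0 z2.
  have [||psi' [psi'P psi'_phi psi'y]] := @place_hom_ext _ (- z) phiP.
  - by rewrite oppr_eq0.
  - by rewrite sqrrN.
  have := place_hom_coords psiP uE vE xI; have := place_hom_coords psi'P uE vE xI.
  rewrite !x0 // !mulr0 psiy psi'y !psi_phi // !psi'_phi //.
  move: (phi (2%:R * u)) (phi (2%:R * v * _)) => t w e1 e2.
  have t0 : t = 0.
    apply: (mulIf z_neq0); apply: (mulfI two_neq0); rewrite mul0r mulr0.
    transitivity ((t * z + w) - (t * - z + w)); first by ring.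
    by rewrite -e1 -e2 subrr.
  by split=> //; move: e2; rewrite t0 mul0r add0r.
have PT : P (2%:R * u) by apply: IH => // phi /TU0 [].
have PU : P (2%:R * v * y ^+ 2) by apply: IH => // phi /TU0 [].
have : P (2%:R * y * (u + v * y)).
  have -> : 2%:R * y * (u + v * y) = (2%:R * u) * y + 2%:R * v * y ^+ 2 by ring.
  by apply: PD => //; [int_sub | apply: PM].
case/Pprime => //; first by int_sub.
by case/Pprime => //; int_sub.
Qed.

End QuadraticStep.

(** * Rational functions and the degree of the tower *)

Lemma frac_numden (R : idomainType) (x : {fraction R}) :
  exists n d : R, d != 0 /\ x = tofrac n / tofrac d.
Proof.
elim/quotW: x => r; exists (\n_r)%R, (\d_r)%R; split; first exact: denom_ratioP.
apply: (canRL (mulfK _)); first by rewrite tofrac_eq0 denom_ratioP.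
rewrite !piE; apply/eqmodP; rewrite /= FracField.equivfE /FracField.mulf.
by rewrite !numden_Ratio ?mulr1 ?denom_ratioP ?oner_eq0 // mulrC.
Qed.

Section PolyFrac.
Variable k : fieldType.
Local Notation frac := (@tofrac {poly k}).

Lemma integral_frac_poly (z : {fraction {poly k}}) :
  integralOver frac z -> exists f, z = frac f.
Proof.
have [n [d [d0 ->]]] := frac_numden z.
have g0 : gcdp n d != 0 by rewrite gcdp_eq0 (negPf d0) andbF.
have cop : coprimep (n %/ gcdp n d) (d %/ gcdp n d).
  by rewrite coprimep_div_gcd // d0 orbT.
have d'0 : d %/ gcdp n d != 0 by rewrite dvdp_div_eq0 ?dvdp_gcdr.
have -> : frac n / frac d = frac (n %/ gcdp n d) / frac (d %/ gcdp n d).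
  rewrite -[X in frac X / _](divpK (dvdp_gcdl n d)).
  rewrite -[X in _ / frac X](divpK (dvdp_gcdr n d)) !rmorphM /=.
  by rewrite -mulf_div divff ?mulr1 // tofrac_eq0.
move: (n %/ _) (d %/ _) cop d'0 => {d0 g0} {}n {}d cop d0.
case=> q q_mon /rootP; set x := _ / _ => qx.
have fd0 : frac d != 0 by rewrite tofrac_eq0.
have [m sz_q] : exists m, size q = m.+1.
  by exists (size q).-1; rewrite prednK // size_poly_gt0 monic_neq0.
have dvd : d %| n ^+ m.
  have : frac d ^+ m * (map_poly frac q).[x] = 0 by rewrite qx mulr0.
  rewrite horner_coef size_map_poly_id0; last first.
    by rewrite (monicP q_mon) rmorph1 oner_eq0.
  rewrite sz_q big_ord_recr /= mulrDr mulr_sumr.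
  have -> : (map_poly frac q)`_m = 1.
    have qm : q`_m = 1 by rewrite -(monicP q_mon) lead_coefE sz_q.
    by rewrite coef_map qm; apply: rmorph1.
  rewrite mul1r -exprMn.
  have -> : frac d * x = frac n by rewrite /x mulrC divfK.
  have summand (i : 'I_m) : frac d ^+ m * ((map_poly frac q)`_i * x ^+ i) =
      frac (d * (q`_i * n ^+ i * d ^+ (m - i).-1)).
    rewrite coef_map /= !rmorphM !rmorphXn /=.
    have -> : frac d ^+ m = frac d * frac d ^+ (m - i).-1 * frac d ^+ i.
      by rewrite -exprS -exprD prednK ?subn_gt0 // subnK // ltnW.
    have <- : frac d * x = frac n by rewrite /x mulrC divfK.
    by rewrite [in RHS]exprMn; ring.
  rewrite (eq_bigr _ (fun i _ => summand i)) -rmorph_sum -mulr_sumr.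
  rewrite -rmorphXn -rmorphD /=.
  move/eqP; rewrite tofrac_eq0 addrC addr_eq0 => /eqP ->.
  by rewrite dvdpNr dvdp_mulr.
have : size d == 1%N.
  rewrite -coprimepp; apply: (coprimep_dvdl dvd); apply: coprimep_expr.
  by rewrite coprimep_sym.
move=> /size_poly1P [c c0 dE].
exists (c^-1 *: n); rewrite /x dE -mul_polyC rmorphM /= mulrC; congr (_ * _).
have fc0 : frac c%:P != 0 by rewrite tofrac_eq0 polyC_eq0.
apply: (mulIf fc0); rewrite mulVf // -rmorphM /= -polyCM mulVf // tofrac1.
Qed.

Lemma frac_sqr_mup (r : k) (f g : {poly k}) (x : {fraction {poly k}}) :
  f != 0 -> g != 0 -> frac f = frac g * x ^+ 2 -> odd (mup r f) = odd (mup r g).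
Proof.
have [n [d [d0 ->]]] := frac_numden x => f0 g0 e.
have fd0 : frac d != 0 by rewrite tofrac_eq0.
have {}e : f * d ^+ 2 = g * n ^+ 2.
  apply/eqP; rewrite -tofrac_eq !expr2 !tofracM e.
  by rewrite -expr2 -mulrA -exprMn divfK // expr2.
have n0 : n != 0.
  apply: contraNneq (mulf_neq0 f0 (expf_neq0 2 d0)) => n0.
  by rewrite e n0 expr0n mulr0.
have /(congr1 odd) := congr1 (mup r) e.
rewrite !mupM ?mulf_neq0 ?expf_neq0 // !oddD.
by rewrite !addbb !addbF.
Qed.
End PolyFrac.

Section Tower.
Variables (p : nat) (p_prime : prime p) (p_odd : odd p).
Variables (L : fieldExtType 'F_p(t)) (s u w : L) (L_R2 : is_R2 s u w).
Local Notation iota := (poly_in L).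
Local Notation frac := (@tofrac {poly 'F_p}).

Lemma poly_inE f : iota f = in_alg L (frac f). Proof. by []. Qed.

Lemma poly_in_inj : injective iota.
Proof.
by move=> f g; rewrite !poly_inE => /fmorph_inj /eqP; rewrite tofrac_eq => /eqP.
Qed.

Lemma integral_base x : x \in 1%VS -> integralOver iota x -> exists f, x = iota f.
Proof.
case/vlineP=> c -> [q q_mon q0].
have [|f ->] := @integral_frac_poly _ c; last by exists f.
exists q => //; move: q0; rewrite map_poly_comp.
by rewrite fmorph_root.
Qed.

Lemma poly_in_mem (E : {subfield L}) f : iota f \in E.
Proof. by rewrite poly_inE rpredZ // rpred1. Qed.

Lemma base_sqr_mup (r : 'F_p) f g (x : L) : x \in 1%VS -> f != 0 -> g != 0 ->
  iota f = iota g * x ^+ 2 -> odd (mup r f) = odd (mup r g).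
Proof.
case/vlineP=> c -> f0 g0 e.
have : in_alg L (frac f) = in_alg L (frac g * c ^+ 2).
  by rewrite rmorphM rmorphXn.
by move/fmorph_inj; apply: frac_sqr_mup.
Qed.

Let X1_neq0 : 1 - 'X != 0 :> {poly 'F_p}.
Proof. by rewrite -opprB oppr_eq0 polyXsubC_eq0. Qed.

Let X_neq0 : 'X != 0 :> {poly 'F_p}. Proof. by rewrite polyX_eq0. Qed.

Let mup_0X : mup 0 ('X : {poly 'F_p}) = 1%N.
Proof. by have := @mup_XsubCX 'F_p 1 0 0; rewrite eqxx expr1 subr0. Qed.

Let mup_11X : mup 1 (1 - 'X : {poly 'F_p}) = 1%N.
Proof.
have -> : 1 - 'X = (-1)%:P * ('X - 1%:P) ^+ 1 :> {poly 'F_p}.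
  by rewrite polyCN mulN1r opprB.
by rewrite mupMr ?mup_XsubCX ?eqxx // rootC oppr_eq0 oner_eq0.
Qed.

Let two_neq0 : 2%:R != 0 :> L.
Proof.
have : (2%:R : 'F_p) != 0.
  rewrite -(dvdn_pcharf (pchar_Fp p_prime)) dvdn_prime2 //.
  by apply: contraTneq p_odd => ->.
apply: contraNneq => e; rewrite -polyC_eq0 -tofrac_eq0.
have : iota (2%:R) = 0 by rewrite rmorph_nat.
rewrite poly_inE -(rmorph0 (in_alg L)) => /fmorph_inj e'.
by rewrite polyC_natr e'.
Qed.

Let s2 : s ^+ 2 = iota 'X. Proof. by case: L_R2. Qed.
Let u2 : u ^+ 2 = iota (1 - 'X). Proof. by case: L_R2; rewrite rmorphB rmorph1. Qed.
Let w2 : w ^+ 2 = 1 + s. Proof. by case: L_R2. Qed.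

Lemma s_notin : s \notin (1%AS : {subfield L}).
Proof.
apply/negP=> s1; have e : iota 'X = iota 1 * s ^+ 2 by rewrite rmorph1 mul1r.
have := base_sqr_mup 0 s1 X_neq0 (oner_neq0 _) e.
by rewrite mup_0X mupNroot // root1.
Qed.

Lemma s2_in : s ^+ 2 \in (1%AS : {subfield L}).
Proof. by rewrite s2 poly_in_mem. Qed.

Lemma nonsquare_1X x : x \in 1%VS -> iota (1 - 'X) <> x ^+ 2.
Proof.
move=> x1 e; have e' : iota (1 - 'X) = iota 1 * x ^+ 2 by rewrite rmorph1 mul1r.
have := base_sqr_mup 1 x1 X1_neq0 (oner_neq0 _) e'.
by rewrite mup_11X mupNroot // root1.
Qed.

Lemma sqr_coords (E : {subfield L}) y a b c : y \notin E -> y ^+ 2 \in E ->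
    a \in E -> b \in E -> c \in E -> c = (a + b * y) ^+ 2 ->
  c = a ^+ 2 \/ c = b ^+ 2 * y ^+ 2.
Proof.
move=> yE y2E aE bE cE e.
have e' : c + 0 * y = (a ^+ 2 + b ^+ 2 * y ^+ 2) + (2%:R * a * b) * y.
  by rewrite e; ring.
have aE2 : a ^+ 2 + b ^+ 2 * y ^+ 2 \in E by mem_sub.
have bE2 : 2%:R * a * b \in E by mem_sub.
have [ce /esym/eqP] := quad_uniq_coords yE cE (rpred0 E) aE2 bE2 e'.
rewrite mulf_eq0 mulf_eq0 (negPf two_neq0) /= => /orP[] /eqP z0.
  by right; rewrite ce z0 expr0n add0r.
by left; rewrite ce z0 expr0n mul0r addr0.
Qed.

Lemma u_notin : u \notin <<1; s>>%AS.
Proof.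
apply/negP=> /(quad_coords s2_in) [[a b] [/= a1 b1 ue]].
have [|||] := @sqr_coords 1%AS s a b (iota (1 - 'X)) s_notin s2_in a1 b1.
- exact: poly_in_mem.
- by rewrite -u2 ue.
- exact: nonsquare_1X.
rewrite s2 mulrC => e.
have := base_sqr_mup 0 b1 X1_neq0 X_neq0 e.
by rewrite mup_0X mupNroot // /root !hornerE subr0 oner_eq0.
Qed.

Lemma u2_in : u ^+ 2 \in <<1; s>>%AS.
Proof. by rewrite u2 poly_in_mem. Qed.

Lemma w2_in : w ^+ 2 \in <<<<1; s>>; u>>%AS.
Proof. by rewrite w2 rpredD ?rpred1 // (subvP_adjoin u) // memv_adjoin. Qed.

(* If w lies in K(u), K = k(s), then 1 + s or (1 + s) / (1 - t) is a square in
   K; taking norms to k makes 1 - t a square in k. *)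
Lemma w_notin : w \notin <<<<1; s>>; u>>%AS.
Proof.
apply/negP=> /(quad_coords u2_in) [[a b] [/= aE bE we]].
have s_in : 1 + s \in <<1; s>>%VS by rewrite rpredD ?rpred1 ?memv_adjoin.
have s2_mem := s2_in.
have step c d : c \in 1%VS -> d \in 1%VS -> forall e, e \in 1%VS ->
    1 + s = e * (c + d * s) ^+ 2 -> 1 - s = e * (c - d * s) ^+ 2.
  move=> c1 d1 e e1; rewrite !expr2 => h.
  have h' : 1 + 1 * s = e * (c ^+ 2 + d ^+ 2 * s ^+ 2) + e * (2%:R * c * d) * s.
    by rewrite mul1r h; ring.
  have [||||h1 h2] := quad_uniq_coords s_notin _ _ _ _ h'.
  - exact: rpred1.
  - exact: rpred1.
  - by mem_sub.
  - by mem_sub.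
  transitivity (e * (c ^+ 2 + d ^+ 2 * s ^+ 2) - e * (2%:R * c * d) * s).
    by rewrite -h1 -h2 mul1r.
  by ring.
have norm : iota (1 - 'X) = (1 + s) * (1 - s).
  by rewrite rmorphB rmorph1 -s2; ring.
have [||] := @sqr_coords <<1; s>>%AS u a b (1 + s) u_notin u2_in aE bE s_in.
- by rewrite -w2 we.
- have [[c d] [/= c1 d1 ->]] := quad_coords s2_in aE.
  rewrite -[X in _ = X]mul1r => h; have h' := step c d c1 d1 1 (rpred1 _) h.
  apply: (@nonsquare_1X (c ^+ 2 - d ^+ 2 * s ^+ 2)).
    by mem_sub.
  by rewrite norm h h'; ring.
have [[c d] [/= c1 d1 ->]] := quad_coords s2_in bE.
rewrite mulrC => h; have u2_1 : u ^+ 2 \in 1%VS by rewrite u2 (poly_in_mem 1%AS).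
have h' := step c d c1 d1 (u ^+ 2) u2_1 h.
apply: (@nonsquare_1X (u ^+ 2 * (c ^+ 2 - d ^+ 2 * s ^+ 2))).
  by mem_sub.
by rewrite norm h h'; ring.
Qed.

End Tower.

(** * Homomorphisms above t = a *)

Lemma integral_of_sqr (R : comNzRingType) (K : fieldType) (iota : {rmorphism R -> K}) y :
  integralOver iota (y ^+ 2) -> integralOver iota y.
Proof.
move=> y2; apply: (@integral_root_monic _ _ _ _ ('X^2 - (y ^+ 2)%:P)).
- by rewrite monicXnsubC.
- by rewrite /root !hornerE subrr.
apply/integral_poly => i; rewrite coefB coefXn coefC.
by apply: integral_sub; [apply: integral_nat | case: ifP => _ //; apply: integral0].
Qed.

Section Places.
Variables (p : nat) (p_prime : prime p) (p_odd : odd p).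
Variables (L : fieldExtType 'F_p(t)) (s u w : L) (L_R2 : is_R2 s u w).
Variables (F : fieldType) (kappa : {rmorphism 'F_p -> F}).
Variables (a : 'F_p) (a_neq0 : a != 0) (a_neq1 : a != 1).
Local Notation iota := (poly_in L).
Local Notation E1 := <<1; s>>%AS.
Local Notation E2 := <<<<1; s>>; u>>%AS.

Definition eval_at : {rmorphism {poly 'F_p} -> F} := kappa \o horner_eval a.
Local Notation place := (place_hom iota eval_at).

Let s2 : s ^+ 2 = iota 'X. Proof. by case: L_R2. Qed.
Let u2 : u ^+ 2 = iota (1 - 'X). Proof. by case: L_R2; rewrite rmorphB rmorph1. Qed.
Let w2 : w ^+ 2 = 1 + s. Proof. by case: L_R2. Qed.
Let fullE : <<<<<<1; s>>; u>>; w>>%VS = fullv. Proof. by case: L_R2. Qed.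

Lemma s_integral : integralOver iota s.
Proof. by apply: integral_of_sqr; rewrite s2; apply: integral_id. Qed.

Lemma u_integral : integralOver iota u.
Proof. by apply: integral_of_sqr; rewrite u2; apply: integral_id. Qed.

Lemma w_integral : integralOver iota w.
Proof.
apply: integral_of_sqr; rewrite w2; apply: integral_add; last exact: s_integral.
exact: integral1.
Qed.

Let two_neq0 : 2%:R != 0 :> F.
Proof.
rewrite -(rmorph_nat kappa) fmorph_eq0 -(dvdn_pcharf (pchar_Fp p_prime)) dvdn_prime2 //.
by apply: contraTneq p_odd => ->.
Qed.

Lemma eval_atE f : eval_at f = kappa f.[a]. Proof. by []. Qed.

Lemma place_s2 E phi : place E phi -> phi (s ^+ 2) = kappa a.
Proof. by case=> phi_iota _ _; rewrite s2 phi_iota eval_atE hornerX. Qed.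

Lemma place_u2 E phi : place E phi -> phi (u ^+ 2) = 1 - kappa a.
Proof.
by case=> phi_iota _ _; rewrite u2 phi_iota eval_atE !hornerE rmorphB rmorph1.
Qed.

Lemma place_w2 (E : {subfield L}) phi : place E phi -> s \in E ->
  phi (w ^+ 2) = 1 + phi s.
Proof.
case=> phi_iota phiD _ sE; rewrite w2 phiD ?rpred1 //; last exact: s_integral.
  by rewrite -(rmorph1 iota) phi_iota rmorph1.
exact: integral1.
Qed.

Lemma place_base : exists phi, place 1%VS phi.
Proof.
have ex x : exists f, x \in 1%VS -> integralOver iota x -> x = iota f.
  case: (pselect (x \in 1%VS /\ integralOver iota x)) => [[x1 xI]|nx].
    by have [f ->] := integral_base x1 xI; exists f.
  by exists 0 => x1 xI; case: nx.
have [g gP] := choice ex.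
have gI f : g (iota f) = f.
  apply: (@poly_in_inj _ L); rewrite -gP //; last exact: integral_id.
  exact: (poly_in_mem 1%AS).
exists (fun x => eval_at (g x)); split=> [f|x y x1 y1 xI yI|x y x1 y1 xI yI].
- by rewrite gI.
- have [[f ->] [h ->]] := (integral_base x1 xI, integral_base y1 yI).
  by rewrite !gI -!rmorphD gI.
- have [[f ->] [h ->]] := (integral_base x1 xI, integral_base y1 yI).
  by rewrite !gI -!rmorphM gI.
Qed.

Lemma place_base_uniq phi psi x : place 1%VS phi -> place 1%VS psi ->
  x \in 1%VS -> integralOver iota x -> phi x = psi x.
Proof.
by move=> [phiE _ _] [psiE _ _] x1 xI; have [f ->] := integral_base x1 xI;
   rewrite phiE psiE.
Qed.

Lemma place_sub (E E' : {vspace L}) phi : (E <= E')%VS -> place E' phi -> place E phi.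
Proof.
move=> /subvP sub [phi_iota phiD phiM].
by split=> // x y /sub xE /sub yE; [apply: phiD | apply: phiM].
Qed.

Let E_iota (E : {subfield L}) f : iota f \in E := poly_in_mem E f.

Lemma sqr_neq0 (x y : F) : x ^+ 2 = y -> y != 0 -> x != 0.
Proof. by move=> <-; rewrite expf_eq0. Qed.

Lemma kappa_neq0 : kappa a != 0. Proof. by rewrite fmorph_eq0. Qed.

Lemma kappa_neq1 : 1 - kappa a != 0.
Proof. by rewrite -(rmorph1 kappa) -rmorphB fmorph_eq0 subr_eq0 eq_sym. Qed.

Lemma root_neq0 b : b ^+ 2 = kappa a -> 1 + b != 0.
Proof.
move=> b2; apply: contraNneq kappa_neq1 => e.
have -> : kappa a = 1 ^+ 2 - (1 + b) * (1 - b) by rewrite -b2; ring.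
by rewrite e mul0r subr0 expr1n subrr.
Qed.

Lemma place_exists b c d : b ^+ 2 = kappa a -> c ^+ 2 = 1 - kappa a ->
    d ^+ 2 = 1 + b ->
  exists phi, [/\ place fullv phi, phi s = b, phi u = c & phi w = d].
Proof.
move=> b2 c2 d2; have [phi0 phi0P] := place_base.
have b_neq0 := sqr_neq0 b2 kappa_neq0; have c_neq0 := sqr_neq0 c2 kappa_neq1.
have d_neq0 := sqr_neq0 d2 (root_neq0 b2).
have [|phi1 [phi1P _ phi1s]] := place_hom_ext (E_iota _) two_neq0 (s_notin L_R2)
  (s2_in L_R2) s_integral phi0P b_neq0.
  by rewrite (place_s2 phi0P).
have [|phi2 [phi2P phi2E phi2u]] := place_hom_ext (E_iota _) two_neq0
  (u_notin p_prime p_odd L_R2) (u2_in L_R2) u_integral phi1P c_neq0.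
  by rewrite (place_u2 phi1P).
have sE1 : s \in E1 by apply: memv_adjoin.
have sE2 : s \in E2 by apply: (subvP_adjoin u).
have phi2s : phi2 s = b by rewrite phi2E //; apply: s_integral.
have [|phi3 [phi3P phi3E phi3w]] := place_hom_ext (E_iota _) two_neq0
  (w_notin p_prime p_odd L_R2) (w2_in L_R2) w_integral phi2P d_neq0.
  by rewrite (place_w2 phi2P) // phi2s.
exists phi3; split=> //; first by rewrite -fullE.
  by rewrite phi3E //; apply: s_integral.
by rewrite phi3E ?memv_adjoin //; apply: u_integral.
Qed.

Lemma place_uniq phi psi x : place fullv phi -> place fullv psi ->
    phi s = psi s -> phi u = psi u -> phi w = psi w ->
  integralOver iota x -> phi x = psi x.
Proof.
move=> phiP psiP es eu ew xI.
have E1full : (E1 <= fullv)%VS := subvf _.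
have E2full : (E2 <= fullv)%VS := subvf _.
have neq0 (E : {subfield L}) y z : place E phi -> y \in E -> integralOver iota y ->
    phi (y ^+ 2) = z -> z != 0 -> phi y != 0.
  by case=> _ _ phiM yE yI <-; rewrite expr2 phiM // mulf_eq0 orbb.
have phis_neq0 : phi s != 0.
  exact: neq0 phiP (memvf s) s_integral (place_s2 phiP) kappa_neq0.
have phiu_neq0 : phi u != 0.
  exact: neq0 phiP (memvf u) u_integral (place_u2 phiP) kappa_neq1.
have phis2 : phi s ^+ 2 = kappa a.
  rewrite -(place_s2 phiP); case: phiP => _ _ phiM.
  by rewrite [in RHS]expr2 phiM ?memvf //; apply: s_integral.
have phiw_neq0 : phi w != 0.
  exact: neq0 phiP (memvf w) w_integral (place_w2 phiP (memvf s)) (root_neq0 phis2).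
have place1 chi : place fullv chi -> place E1 chi by apply: place_sub E1full.
have place2 chi : place fullv chi -> place E2 chi by apply: place_sub E2full.
have place0 chi : place fullv chi -> place 1%VS chi by apply: place_sub (subvf _).
have e0 y : y \in 1%VS -> integralOver iota y -> phi y = psi y.
  by apply: place_base_uniq; apply: place0.
have e1 y : y \in E1 -> integralOver iota y -> phi y = psi y.
  exact: (place_hom_uniq (E_iota _) two_neq0 (s_notin L_R2)
    (s2_in L_R2) s_integral (place1 _ phiP) (place1 _ psiP) e0 es phis_neq0).
have e2 y : y \in E2 -> integralOver iota y -> phi y = psi y.
  exact: (place_hom_uniq (E_iota _) two_neq0 (u_notin p_prime p_odd L_R2)
    (u2_in L_R2) u_integral (place2 _ phiP) (place2 _ psiP) e1 eu phiu_neq0).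
rewrite -fullE in phiP psiP.
apply: (place_hom_uniq (E_iota _) two_neq0 (w_notin p_prime p_odd L_R2)
    (w2_in L_R2) w_integral phiP psiP e2 ew phiw_neq0 _ xI).
by rewrite fullE memvf.
Qed.

Lemma place_separate (P : L -> Prop) :
    (forall x z, integralOver iota x -> integralOver iota z ->
       P x -> P z -> P (x + z)) ->
    (forall x z, integralOver iota x -> integralOver iota z ->
       P x -> P (x * z)) ->
    (forall x z, integralOver iota x -> integralOver iota z ->
       P (x * z) -> P x \/ P z) ->
    (forall f, P (iota f) <-> f.[a] = 0) ->
    (exists b : F, b ^+ 2 = kappa a) -> (exists c : F, c ^+ 2 = 1 - kappa a) ->
    (forall b : F, b ^+ 2 = kappa a -> exists d, d ^+ 2 = 1 + b) ->
  forall x, integralOver iota x ->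
    (forall phi, place fullv phi -> phi x = 0) -> P x.
Proof.
move=> PD PM Pprime Pa [b b2] [c c2] sqr_d x xI x0.
have P2 : ~ P 2%:R.
  rewrite -(rmorph_nat iota) Pa -polyC_natr hornerC => e.
  by move: two_neq0; rewrite -(rmorph_nat kappa) e rmorph0 eqxx.
have Psqr y : integralOver iota y -> P y -> P (y ^+ 2) by move=> yI; apply: PM.
have Ps : ~ P s.
  move/(Psqr _ s_integral); rewrite s2 Pa hornerX => /eqP.
  by apply/negP.
have Pu : ~ P u.
  move/(Psqr _ u_integral); rewrite u2 Pa !hornerE => /eqP.
  by rewrite subr_eq0 eq_sym; apply/negP.
have Pw : ~ P w.
  move/(Psqr _ w_integral); rewrite w2 => P1s; apply: Pu.
  have I1s : integralOver iota (1 + s).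
    by apply: integral_add; [apply: integral1 | apply: s_integral].
  have I1s' : integralOver iota (1 - s).
    by apply: integral_sub; [apply: integral1 | apply: s_integral].
  have := PM _ _ I1s I1s' P1s.
  have -> : (1 + s) * (1 - s) = u * u.
    by rewrite -[RHS]expr2 u2 rmorphB rmorph1 -s2; ring.
  by case/Pprime=> //; apply: u_integral.
have sep0 y : y \in 1%AS -> integralOver iota y ->
    (forall phi, place 1%AS phi -> phi y = 0) -> P y.
  move=> y1 yI y0; have [f ye] := integral_base y1 yI.
  have [phi phiP] := place_base; have := y0 phi phiP.
  case: phiP => phi_iota _ _; rewrite ye phi_iota eval_atE => /eqP.
  by rewrite fmorph_eq0 Pa => /eqP.
have sqr0 phi : place 1%AS phi -> exists2 z, z != 0 & z ^+ 2 = phi (s ^+ 2).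
  by move=> /place_s2 ->; exists b => //; apply: sqr_neq0 b2 kappa_neq0.
have sqr1 phi : place E1 phi -> exists2 z, z != 0 & z ^+ 2 = phi (u ^+ 2).
  by move=> /place_u2 ->; exists c => //; apply: sqr_neq0 c2 kappa_neq1.
have sqr2 phi : place E2 phi -> exists2 z, z != 0 & z ^+ 2 = phi (w ^+ 2).
  move=> phiP; have sE2 : s \in E2 by rewrite (subvP_adjoin u) ?memv_adjoin.
  have phis2 : phi s ^+ 2 = kappa a.
    rewrite -(place_s2 phiP); case: phiP => _ _ phiM.
    by rewrite [in RHS]expr2 phiM //; apply: s_integral.
  have [d d2] := sqr_d _ phis2; rewrite (place_w2 phiP) //.
  by exists d => //; apply: sqr_neq0 d2 (root_neq0 phis2).
have sep1 := place_hom_separate (E_iota _) two_neq0 (s_notin L_R2)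
  (s2_in L_R2) s_integral PD PM Pprime P2 Ps sqr0 sep0.
have sep2 := place_hom_separate (E_iota _) two_neq0 (u_notin p_prime p_odd L_R2)
  (u2_in L_R2) u_integral PD PM Pprime P2 Pu sqr1 sep1.
have sep3 := place_hom_separate (E_iota _) two_neq0 (w_notin p_prime p_odd L_R2)
  (w2_in L_R2) w_integral PD PM Pprime P2 Pw sqr2 sep2.
by apply: sep3 => //; rewrite ?fullE ?memvf.
Qed.

End Places.

(** * Finite fields and the Frobenius action on the points *)

Section FiniteField.
Variables (p : nat) (p_prime : prime p) (F : finFieldType).
Variable kappa : {rmorphism 'F_p -> F}.

Let pcharF : p \in [pchar F].
Proof. by rewrite (fmorph_pchar kappa) pchar_Fp. Qed.

Lemma kappaX_p c : kappa c ^+ p = kappa c.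
Proof. by rewrite -rmorphXn -[in RHS](expf_card c) card_Fp. Qed.

Lemma kappa_nat c : kappa c = (c : nat)%:R.
Proof. by rewrite -[in LHS](natr_Zp c) rmorph_nat. Qed.

Lemma frob_fixed x : x ^+ p = x -> exists c, x = kappa c.
Proof.
move=> xp; have : root (\prod_c ('X - (kappa c)%:P)) x.
  have -> : \prod_c ('X - (kappa c)%:P) = map_poly kappa ('X^#|'F_p| - 'X).
    rewrite finField_genPoly rmorph_prod; apply: eq_bigr => c _.
    by rewrite rmorphB /= map_polyX map_polyC.
  rewrite card_Fp // rmorphB rmorphXn /= map_polyX.
  by rewrite /root !hornerE xp subrr.
rewrite -(big_map kappa predT (fun x => 'X - x%:P)) root_prod_XsubC.
by case/mapP=> c _ ->; exists c.
Qed.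

(* A generator of the multiplicative group of the common residue field is sent
   by [h2] to a conjugate of its image under [h1], and this determines [h2]. *)
Lemma same_kernel_frob n (R : comNzRingType) (h1 h2 : {rmorphism R -> F}) :
    #|F| = (p ^ n)%N -> (forall x, h1 x = 0 -> h2 x = 0) ->
  exists i, forall x, h2 x = h1 x ^+ (p ^ i).
Proof.
move=> cardF ker12.
pose G := [set v : {unit F} | `[< exists x, val v = h1 x >]].
have gG : group_set G.
  apply/group_setP; split=> [|v v']; rewrite !finset.inE.
    by apply/asboolP; exists 1; rewrite rmorph1.
  move=> /asboolP[x ex] /asboolP[x' ex']; apply/asboolP.
  by exists (x * x'); rewrite rmorphM -ex -ex'.
have /cyclicP[v Gv] := field_unit_group_cyclic (group gG).
have : v \in G by have /= -> := Gv; apply: cycle_id.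
rewrite finset.inE => /asboolP[x vx].
pose Q := \prod_(i < n) ('X - (h1 x ^+ (p ^ i))%:P).
have n_gt0 : (0 < n)%N.
  by rewrite lt0n; apply: contraTneq (card_finRing_gt1 F) => n0; rewrite cardF n0.
have QF : map_poly (pFrobenius_aut pcharF) Q = Q.
  rewrite rmorph_prod /Q.
  case: (n) n_gt0 cardF => // m _ cardF.
  rewrite big_ord_recr big_ord_recl /= mulrC; congr (_ * _).
    rewrite rmorphB /= map_polyX map_polyC /= pFrobenius_autE -exprM -expnSr.
    by rewrite -cardF expf_card expn0 expr1.
  apply: eq_bigr => i _; rewrite rmorphB /= map_polyX map_polyC /=.
  by rewrite pFrobenius_autE -exprM -expnSr.
have [q qP] : exists q : nat -> 'F_p, forall i, Q`_i = kappa (q i).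
  have ex i : exists c, Q`_i = kappa c.
    by apply: frob_fixed; rewrite -[in RHS]QF coef_map /= pFrobenius_autE.
  by have [q qP] := choice ex; exists q.
pose y := \sum_(i < size Q) (q i : nat)%:R * x ^+ i.
have hy (h : {rmorphism R -> F}) : h y = Q.[h x].
  rewrite rmorph_sum horner_coef; apply: eq_bigr => i _.
  by rewrite rmorphM rmorphXn rmorph_nat qP kappa_nat.
have : root Q (h2 x).
  rewrite /root -hy ker12 // hy /Q; case: (n) n_gt0 => // m _.
  by rewrite big_ord_recl hornerM hornerXsubC expn0 expr1 subrr mul0r.
rewrite /Q -(big_map (fun i : 'I_n => h1 x ^+ (p ^ i)) predT (fun x => 'X - x%:P)).
rewrite root_prod_XsubC => /mapP[i _ h2x]; exists i => z.
have [z0|z0] := eqVneq (h1 z) 0.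
  by rewrite ker12 // z0 expr0n expn_eq0 eqn0Ngt prime_gt0.
have uz : h1 z \is a GRing.unit by rewrite unitfE.
have : FinRing.unit F uz \in G by rewrite finset.inE; apply/asboolP; exists z.
have /= -> := Gv; case/cycleP=> k /(congr1 val); rewrite /= => zk.
have h1z : h1 z = h1 (x ^+ k).
  by rewrite zk FinRing.val_unitX vx rmorphXn.
have : h2 (z - x ^+ k) = 0 by apply: ker12; rewrite rmorphB h1z subrr.
rewrite rmorphB => /eqP; rewrite subr_eq0 => /eqP ->.
by rewrite h1z !rmorphXn h2x -!exprM mulnC.
Qed.

Lemma sqr_of_expf_half (x : F) : odd #|F| -> x ^+ (#|F|.-1)./2 = 1 -> exists z, z ^+ 2 = x.
Proof.
move=> oddF xh.
have x0 : x != 0.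
  apply: contraTneq (oner_neq0 F) => x0; rewrite -xh x0 expr0n.
  have := card_finRing_gt1 F; have := oddF; case: #|F| => [|[|[|m]]] //= _ _.
  by rewrite eqxx.
have /cyclicP[v Gv] := field_unit_group_cyclic [set: {unit F}]%G.
have uz : x \is a GRing.unit by rewrite unitfE.
have : FinRing.unit F uz \in [set: {unit F}] by rewrite finset.inE.
have /= -> := Gv; case/cycleP=> k /(congr1 val); rewrite /= FinRing.val_unitX => xk.
have ov : #[v]%g = #|F|.-1 by rewrite orderE -Gv card_finField_unit.
have : (v ^+ (k * (#|F|.-1)./2))%g = 1%g.
  by apply: val_inj; rewrite FinRing.val_unitX exprM -xk xh.
move/eqP; rewrite -order_dvdn ov => dv.
have F1 : (0 < (#|F|.-1)./2)%N.
  have := card_finRing_gt1 F; have := oddF; by case: #|F| => [|[|[|m]]].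
have : (2 %| k)%N.
  rewrite -(dvdn_pmul2r F1); apply: dvdn_trans dv.
  rewrite mul2n -[X in (_ %| X)%N]odd_double_half.
  by rewrite -subn1 oddB ?(ltnW (card_finRing_gt1 F)) // oddF.
by case/dvdnP=> j kj; exists (val v ^+ j); rewrite xk kj exprM.
Qed.

End FiniteField.

Section Points.
Variables (p : nat) (p_prime : prime p) (p_odd : odd p) (F : finFieldType).
Variables (kappa : {rmorphism 'F_p -> F}) (a : 'F_p).
Hypotheses (a_neq0 : a != 0) (a_neq1 : a != 1) (a_neq_half : a != 2%:R^-1).

Definition points : {set F * F * F} :=
  [set x | [&& x.1.1 ^+ 2 == kappa a, x.1.2 ^+ 2 == 1 - kappa a
             & x.2 ^+ 2 == 1 + x.1.1]].

Definition frob (x : F * F * F) : F * F * F := (x.1.1 ^+ p, x.1.2 ^+ p, x.2 ^+ p).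

Let pcharF : p \in [pchar F].
Proof. by rewrite (fmorph_pchar kappa) pchar_Fp. Qed.

Let two_neq0 : 2%:R != 0 :> F.
Proof.
rewrite -(dvdn_pcharf pcharF) dvdn_prime2 //.
by apply: contraTneq p_odd => ->.
Qed.

Let pE : p = (p.-1)./2.*2.+1.
Proof.
have := prime_gt0 p_prime; have := p_odd; case: (p) => // n /= on _.
by rewrite even_halfK.
Qed.

Lemma exprpD (x y : F) : (x + y) ^+ p = x ^+ p + y ^+ p.
Proof. exact: (rmorphD (pFrobenius_aut pcharF)). Qed.

Lemma exprp_inj : injective (fun x : F => x ^+ p).
Proof. exact: (fmorph_inj (pFrobenius_aut pcharF)). Qed.

Lemma exprp_sqr (x : F) : x ^+ p = (x ^+ 2) ^+ (p.-1)./2 * x.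
Proof. by rewrite {1}pE exprSr -mul2n exprM. Qed.

Lemma exprp_pm1 (x : F) : x ^+ 2 = 1 -> x ^+ p = x.
Proof. by move=> x2; rewrite exprp_sqr x2 expr1n mul1r. Qed.

Lemma A2_horner (b : F) : b ^+ 2 = kappa a ->
  2%:R * kappa (A2 p).[a] = (1 - b) ^+ (p.-1)./2 + (1 + b) ^+ (p.-1)./2.
Proof.
move=> b2; rewrite -(horner_map kappa) /= -b2.
have -> : (map_poly kappa (A2 p)).[b ^+ 2] = (map_poly kappa (A2_sqrt p)).[b].
  by rewrite -A2E map_comp_poly horner_comp /= map_polyXn hornerXn.
rewrite /A2_sqrt linearZ /= rmorphD !rmorphXn /= rmorphB rmorphD rmorph1 /= map_polyX.
by rewrite !hornerE fmorphV rmorph_nat /= divff // mul1r.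
Qed.

Section OnePoint.
Variables (x : F * F * F) (xD : x \in points).
Local Notation b := x.1.1.
Local Notation c := x.1.2.
Local Notation d := x.2.
Local Notation m := (p.-1)./2.
Local Notation alpha := (kappa a).
Local Notation Aa := (kappa (A2 p).[a]).

Let beta := alpha ^+ m.
Let gamma := (1 - alpha) ^+ m.
Let delta := (1 + b) ^+ m.
Let delta' := (1 - b) ^+ m.

Let b2 : b ^+ 2 = alpha. Proof. by move: xD; rewrite inE => /and3P[/eqP]. Qed.
Let c2 : c ^+ 2 = 1 - alpha. Proof. by move: xD; rewrite inE => /and3P[_ /eqP]. Qed.
Let d2 : d ^+ 2 = 1 + b. Proof. by move: xD; rewrite inE => /and3P[_ _ /eqP]. Qed.

Let alpha0 : alpha != 0. Proof. by rewrite fmorph_eq0. Qed.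
Let alpha1 : 1 - alpha != 0.
Proof. by rewrite -(rmorph1 kappa) -rmorphB fmorph_eq0 subr_eq0 eq_sym. Qed.
Let alphah : 1 - alpha != alpha.
Proof.
apply: contra a_neq_half => /eqP e; rewrite -(inj_eq (fmorph_inj kappa)).
rewrite fmorphV rmorph_nat; apply/eqP; apply: (mulfI two_neq0).
by rewrite divff // -[RHS](subrK alpha) e; ring.
Qed.

Let norm : (1 + b) * (1 - b) = 1 - alpha. Proof. by rewrite -b2; ring. Qed.
Let b1 : 1 + b != 0. Proof. by apply: contraNneq alpha1 => e; rewrite -norm e mul0r. Qed.
Let b1' : 1 - b != 0. Proof. by apply: contraNneq alpha1 => e; rewrite -norm e mulr0. Qed.
Let b0 : b != 0. Proof. by apply: contraNneq alpha0 => e; rewrite -b2 e expr0n. Qed.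
Let c0 : c != 0. Proof. by apply: contraNneq alpha1 => e; rewrite -c2 e expr0n. Qed.
Let d0 : d != 0. Proof. by apply: contraNneq b1 => e; rewrite -d2 e expr0n. Qed.

Let frobE : frob x = (beta * b, gamma * c, delta * d).
Proof. by rewrite /frob !exprp_sqr b2 c2 d2. Qed.

Let sqr_half (y : F) : y != 0 -> y ^+ p = y -> (y ^+ m) ^+ 2 = 1.
Proof.
move=> y0 yp; apply: (mulIf y0).
by rewrite mul1r -exprM mulnC exprM -exprp_sqr.
Qed.

Let beta2 : beta ^+ 2 = 1. Proof. by rewrite sqr_half // kappaX_p. Qed.
Let gamma2 : gamma ^+ 2 = 1.
Proof. by rewrite sqr_half // -(rmorph1 kappa) -rmorphB kappaX_p. Qed.
Let dd' : delta * delta' = gamma. Proof. by rewrite -exprMn norm. Qed.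
Let A2a : 2%:R * Aa = delta' + delta. Proof. exact: A2_horner. Qed.

Let pm1 (y : F) : y ^+ 2 = 1 -> y = 1 \/ y = -1.
Proof. by move/eqP; rewrite sqrf_eq1 => /orP[] /eqP; [left | right]. Qed.

Let one_neqN1 : (1 : F) <> -1.
Proof. by move/eqP; rewrite -subr_eq0 opprK; apply/negP. Qed.

Let bp : b ^+ p = beta * b. Proof. by rewrite exprp_sqr b2. Qed.
Let N1p : (-1 : F) ^+ p = -1. Proof. by rewrite exprp_pm1 // sqrrN expr1n. Qed.

Let split_case : beta = 1 -> delta ^+ 2 = 1 /\ delta' ^+ 2 = 1.
Proof.
move=> e; have {}e : b ^+ p = b by rewrite bp e mul1r.
split; apply: sqr_half => //; rewrite exprpD expr1n ?e //.
by rewrite -mulN1r exprMn N1p e.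
Qed.

Let inert_case : beta = -1 ->
  delta ^+ p = delta' /\ 2%:R * Aa ^+ 2 * (1 - alpha) = 1 + alpha + gamma * (1 - alpha).
Proof.
move=> e; have {}e : b ^+ p = - b by rewrite bp e mulN1r.
have e1 : (1 + b) ^+ p = 1 - b by rewrite exprpD expr1n e.
have e2 : (1 - b) ^+ p = 1 + b.
  by rewrite exprpD expr1n -mulN1r exprMn N1p e mulN1r opprK.
have hlf (y : F) : y ^+ p = (y ^+ m) ^+ 2 * y.
  by rewrite exprp_sqr -!exprM mulnC.
split; first by rewrite -exprM mulnC exprM e1.
apply: (mulfI two_neq0).
have -> : 2%:R * (2%:R * Aa ^+ 2 * (1 - alpha)) = (2%:R * Aa) ^+ 2 * (1 - alpha) by ring.
rewrite A2a -norm.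
have -> : (delta' + delta) ^+ 2 * ((1 + b) * (1 - b)) =
  (delta' ^+ 2 * (1 - b)) * (1 + b) + (delta ^+ 2 * (1 + b)) * (1 - b)
  + 2%:R * (delta * delta') * ((1 + b) * (1 - b)) by ring.
by rewrite -!hlf e1 e2 dd' -b2; ring.
Qed.

Let frob2E : frob (frob x) =
  (b, c, (if beta == 1 then 1 else gamma) * d).
Proof.
have s (y : F) : y ^+ 2 = 1 -> y ^+ p * y = 1 by move=> y2; rewrite exprp_pm1.
rewrite {1}frobE /frob /= !exprMn !(exprp_sqr b, exprp_sqr c, exprp_sqr d) b2 c2 d2.
rewrite -/beta -/gamma -/delta !mulrA (s beta) // (s gamma) // !mul1r; congr (_, _, _ * _).
case: eqP => e; first by rewrite s // (proj1 (split_case e)).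
have [//|{}e] := pm1 beta2.
by rewrite (proj1 (inert_case e)) mulrC dd'.
Qed.

Let classify :
  [\/ [/\ beta = 1, gamma = 1, delta = 1 & Aa = 1],
      [/\ beta = 1, gamma = 1, delta = -1 & Aa = -1],
      [/\ beta = 1, gamma = -1 & Aa = 0]
    | beta = -1 /\ (gamma = 1 /\ Aa ^+ 2 * (1 - alpha) = 1 \/
                    gamma = -1 /\ Aa ^+ 2 * (1 - alpha) = alpha)].
Proof.
have half (y z : F) : 2%:R * y = z + z -> y = z.
  by move=> e; apply: (mulfI two_neq0); rewrite e; ring.
have [e|e] := pm1 beta2; last first.
  apply: Or44; split=> //; have [_] := inert_case e.
  have [g|g] := pm1 gamma2; rewrite g => h; [left|right]; split=> //;
    by apply: half; rewrite mulrA h; ring.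
have [D D'] := split_case e; have := A2a; have := dd'.
have [e1|e1] := pm1 D; have [e2|e2] := pm1 D'; rewrite e1 e2.
- by rewrite mul1r => g /half A1; apply: Or41.
- rewrite mul1r addNr => g /eqP; rewrite mulf_eq0 (negPf two_neq0) => /eqP A1.
  by apply: Or43.
- rewrite mulr1 subrr => g /eqP; rewrite mulf_eq0 (negPf two_neq0) => /eqP A1.
  by apply: Or43.
- by rewrite mulrNN mulr1 => g /half A1; apply: Or42.
Qed.

Let scale_neq (y z : F) : y != 0 -> z = -1 -> z * y <> y.
Proof.
move=> y0 -> /eqP; rewrite mulN1r -subr_eq0 -opprD oppr_eq0 -mulr2n -mulr_natl.
by rewrite mulf_eq0 (negPf two_neq0) (negPf y0).
Qed.

Let neq10 : (1 : F) <> 0. Proof. by move/eqP; rewrite oner_eq0. Qed.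
Let a_not1 : 1 - alpha <> 1.
Proof. by move/eqP; rewrite subr_eq addrC -subr_eq subrr eq_sym; apply/negP. Qed.
Let a_noth : 1 - alpha <> alpha. Proof. exact/eqP. Qed.
Let a_not0 : alpha <> 0. Proof. exact/eqP. Qed.

Lemma frob_order1 : Aa = 1 -> frob x = x.
Proof.
move=> A1; rewrite frobE; move: classify; rewrite A1 expr1n mul1r.
case=> [[-> -> -> _]|[_ _ _ /one_neqN1]|[_ _ /neq10]|[_ [[_ /a_not1]|[_ /a_noth]]]] //.
by rewrite !mul1r; case: (x) => [[]].
Qed.

Lemma frob_order2 : Aa = -1 \/ Aa = 0 \/ Aa ^+ 2 * (1 - alpha) = 1 ->
  frob x <> x /\ frob (frob x) = x.
Proof.
move=> A1; suff [ne e] : frob x <> x /\ (beta = 1 \/ gamma = 1).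
  split=> //; rewrite frob2E.
  have -> : (if beta == 1 then 1 else gamma) = 1 by case: eqP e => // nb [].
  by rewrite mul1r; case: (x) => [[]].
suff [bg e] : (beta = 1 \/ gamma = 1) /\ [\/ beta = -1, gamma = -1 | delta = -1].
  split=> //; rewrite frobE => fx.
  have e1 := congr1 (fun y => y.1.1) fx; have e2 := congr1 (fun y => y.1.2) fx.
  have e3 := congr1 snd fx; move: e1 e2 e3 => /= e1 e2 e3.
  by case: e => /scale_neq; [move/(_ _ b0) | move/(_ _ c0) | move/(_ _ d0)].
case: classify A1 => [[-> -> -> ->]|[-> -> -> _] _|[-> -> _] _|[-> [[-> _] _|[-> h]]]].
- rewrite expr1n mul1r => -[/one_neqN1 //|[/neq10 //|/a_not1 //]].
- by split; [left | apply: Or33].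
- by split; [left | apply: Or32].
- by split; [right | apply: Or31].
case=> [e|[e|e]]; exfalso; move: h; rewrite e.
- by rewrite sqrrN expr1n mul1r => /a_noth.
- by rewrite expr0n mul0r => /esym /a_not0.
by move=> e1; case/eqP: alpha1; rewrite -e1 subrr.
Qed.

Lemma frob_order4 : Aa ^+ 2 * (1 - alpha) = alpha ->
  frob (frob x) <> x /\ frob (frob (frob (frob x))) = x.
Proof.
move=> A1; have [e1 e2] : beta = -1 /\ gamma = -1.
  case: classify A1 => [[_ _ _ ->]|[_ _ _ ->]|[_ _ ->]|[-> [[-> ->]|[-> _]]]] //.
  - by rewrite expr1n mul1r => /a_noth.
  - by rewrite sqrrN expr1n mul1r => /a_noth.
  - by rewrite expr0n mul0r => /esym /a_not0.
  by move=> e; case/eqP: alpha1; rewrite -e subrr.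
have fx : frob (frob x) = (b, c, -1 * d).
  by rewrite frob2E e1 ifN ?e2 // eq_sym; apply/eqP.
split.
  by rewrite fx => /(congr1 snd) /=; apply: scale_neq.
have frobN y : frob (y.1.1, y.1.2, -1 * y.2) =
    ((frob y).1.1, (frob y).1.2, -1 * (frob y).2).
  by rewrite /frob /= exprMn N1p.
have -> : frob (frob (frob (frob x))) =
    ((frob (frob x)).1.1, (frob (frob x)).1.2, -1 * (frob (frob x)).2).
  by rewrite {1}fx !frobN.
by rewrite fx /= !mulN1r opprK; case: (x) => [[]].
Qed.

End OnePoint.
End Points.

Arguments frob p {F} x.

Lemma half_sqr_pred q : odd q -> ((q ^ 2).-1./2 = q.-1 * q.+1./2)%N.
Proof.
move=> oq; rewrite -[q]odd_double_half oq add1n; move: q./2 => k.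
have -> : (k.*2.+2)./2 = k.+1 by rewrite -doubleS doubleK.
by rewrite -[RHS]doubleK; congr _./2; rewrite -mulnn -!muln2; lia.
Qed.

Section PointCount.
Variables (p : nat) (p_prime : prime p) (p_odd : odd p) (F : finFieldType).
Variables (kappa : {rmorphism 'F_p -> F}) (a : 'F_p).
Hypotheses (a_neq0 : a != 0) (a_neq1 : a != 1) (cardF : #|F| = (p ^ 4)%N).

Let pcharF : p \in [pchar F].
Proof. by rewrite (fmorph_pchar kappa) pchar_Fp. Qed.

Lemma sqrt_exists (x : F) : x ^+ (p ^ 2) = x -> exists z, z ^+ 2 = x.
Proof.
have [->|x0] := eqVneq x 0; first by exists 0; rewrite expr0n.
move=> xp; apply: sqr_of_expf_half; first by rewrite cardF oddX p_odd.
have p2 : (0 < p ^ 2)%N by rewrite expn_gt0 prime_gt0.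
have x1 : x ^+ (p ^ 2).-1 = 1 by apply: (mulIf x0); rewrite -exprSr prednK // mul1r.
have -> : ((#|F|.-1)./2 = (p ^ 2).-1 * (p ^ 2).+1./2)%N.
  rewrite cardF (expnM p 2 2); apply: half_sqr_pred => //.
  by rewrite oddX p_odd orbT.
by rewrite exprM x1 expr1n.
Qed.

Lemma sqrt_alpha : exists b : F, b ^+ 2 = kappa a.
Proof. by apply: sqrt_exists; rewrite expnS expn1 exprM !kappaX_p. Qed.

Lemma sqrt_1alpha : exists b : F, b ^+ 2 = 1 - kappa a.
Proof.
by apply: sqrt_exists; rewrite -(rmorph1 kappa) -rmorphB expnS expn1 exprM !kappaX_p.
Qed.

Lemma sqrt_1root (b : F) : b ^+ 2 = kappa a -> exists d, d ^+ 2 = 1 + b.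
Proof.
move=> b2; apply: sqrt_exists; rewrite expnS expn1 exprM.
rewrite !(exprpD p_prime kappa) !expr1n; congr (_ + _).
have : (b ^+ p) ^+ 2 == b ^+ 2 by rewrite -exprM mulnC exprM b2 kappaX_p.
rewrite eqf_sqr => /orP[] /eqP e; rewrite e // -mulN1r exprMn e.
by rewrite exprp_pm1 // ?sqrrN ?expr1n // mulrNN mul1r.
Qed.

Lemma card_points : #|points kappa a| = 8%N.
Proof.
have [b b2] := sqrt_alpha; have [c c2] := sqrt_1alpha.
have [d d2] := sqrt_1root b2.
have b2' : (- b) ^+ 2 = kappa a by rewrite sqrrN.
have [d' d2'] := sqrt_1root b2'.
pose e (t : bool) : F := (-1) ^+ t.
pose g (t : bool * bool * bool) : F * F * F :=
  (e t.1.1 * b, e t.1.2 * c, e t.2 * (if t.1.1 then d' else d)).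
have e2 t : e t ^+ 2 = 1 by rewrite /e sqrr_sign.
have two_neq0 : 2%:R != 0 :> F.
  rewrite -(dvdn_pcharf pcharF) dvdn_prime2 //.
  by apply: contraTneq p_odd => ->.
have e_inj (y : F) : y != 0 -> injective (fun t => e t * y).
  move=> y0 t t' /(mulIf y0); rewrite /e; case: t t' => [] [] //=; rewrite expr0 expr1.
    by move=> h; case/eqP: two_neq0; rewrite mulr2n -{1}h addNr.
  by move=> h; case/eqP: two_neq0; rewrite mulr2n {1}h addNr.
have b0 : b != 0 by apply: contraNneq (a_neq0) => h; rewrite -(fmorph_eq0 kappa) -b2 h expr0n.
have n1 : 1 - kappa a != 0.
  by rewrite -(rmorph1 kappa) -rmorphB fmorph_eq0 subr_eq0 eq_sym.
have c0 : c != 0 by apply: contraNneq n1 => h; rewrite -c2 h expr0n.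
have d0 : d != 0.
  apply: contraNneq n1 => h; have -> : 1 - kappa a = (1 + b) * (1 - b) by rewrite -b2; ring.
  by rewrite -d2 h expr0n mul0r.
have d0' : d' != 0.
  apply: contraNneq n1 => h; have -> : 1 - kappa a = (1 - b) * (1 + b) by rewrite -b2; ring.
  by rewrite -d2' h expr0n mul0r.
have g_inj : injective g.
  move=> [[t1 t2] t3] [[t1' t2'] t3'] [].
  move=> /(e_inj _ b0) <- /(e_inj _ c0) <-.
  by case: t1 => [/(e_inj _ d0')|/(e_inj _ d0)] <-.
have pm (x y : F) : x ^+ 2 = y ^+ 2 -> exists t, x = e t * y.
  move/eqP; rewrite eqf_sqr => /orP[] /eqP ->; [exists false | exists true].
    by rewrite /e expr0 mul1r.
  by rewrite /e expr1 mulN1r.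
have -> : points kappa a = g @: [set: bool * bool * bool].
  apply/setP=> -[[x y] z]; apply/idP/imsetP => [|[[[t1 t2] t3] _ ->]]; last first.
    rewrite inE /= !exprMn !e2 !mul1r b2 c2 !eqxx /=.
    by case: t1; rewrite /= ?d2 ?d2' /e ?expr0 ?expr1 ?mul1r ?mulN1r.
  rewrite inE /= => /and3P[/eqP x2 /eqP y2 /eqP z2].
  have [t1 xe] : exists t, x = e t * b by apply: pm; rewrite x2.
  have [t2 ye] : exists t, y = e t * c by apply: pm; rewrite y2.
  have [t3 ze] : exists t, z = e t * (if t1 then d' else d).
    apply: pm; rewrite z2 xe /e; case: (t1); rewrite ?d2 ?d2' ?expr0 ?expr1.
      by rewrite mulN1r.
    by rewrite mul1r.
  by exists (t1, t2, t3); rewrite ?inE // /g /= -xe -ye -ze.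
by rewrite card_imset // cardsT !card_prod card_bool.
Qed.

Lemma frob_inj : injective (@frob p F).
Proof.
move=> [[x y] z] [[x' y'] z']; case.
by move=> /(exprp_inj p_prime kappa) -> /(exprp_inj p_prime kappa) ->
  /(exprp_inj p_prime kappa) ->.
Qed.

Lemma frob_points x : x \in points kappa a -> frob p x \in points kappa a.
Proof.
rewrite !inE /= => /and3P[/eqP x2 /eqP y2 /eqP z2]; apply/and3P; split; apply/eqP.
- by rewrite -exprM mulnC exprM x2 kappaX_p.
- by rewrite -exprM mulnC exprM y2 -(rmorph1 kappa) -rmorphB kappaX_p.
- by rewrite -exprM mulnC exprM z2 (exprpD p_prime kappa) expr1n.
Qed.

Lemma frob_closed : fclosed (@frob p F) (mem (points kappa a)).
Proof.
apply: (intro_closed (fconnect_sym frob_inj)) => x _ /eqP <-.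
exact: frob_points.
Qed.

End PointCount.

Section Order.
Variables (T : finType) (f : T -> T) (f_inj : injective f).

Lemma order_eq1 x : f x = x -> fingraph.order f x = 1%N.
Proof. by move=> fx; apply: (@order_cycle _ f [:: x]); rewrite /= ?fx ?eqxx ?inE. Qed.

Lemma order_eq2 x : f x <> x -> f (f x) = x -> fingraph.order f x = 2%N.
Proof.
move=> ne e; apply: (@order_cycle _ f [:: x; f x]).
- by rewrite /= e !eqxx.
- by rewrite /= inE andbT; apply/eqP => h; apply: ne.
- by rewrite inE eqxx.
Qed.

Lemma order_eq4 x : f (f x) <> x -> f (f (f (f x))) = x -> fingraph.order f x = 4%N.
Proof.
move=> ne e; have ne1 : f x <> x by move=> h; apply: ne; rewrite !h.
have ne3 : f (f (f x)) <> x by move=> h; apply: ne1; rewrite -{1}h e.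
apply: (@order_cycle _ f [:: x; f x; f (f x); f (f (f x))]).
- by rewrite /= e !eqxx.
- rewrite /= !inE !(inj_eq f_inj) ![x == _]eq_sym.
  by rewrite (introF eqP ne) (introF eqP ne1) (introF eqP ne3).
- by rewrite inE eqxx.
Qed.
End Order.

(** * Counting the primes *)

Section Primes.
Variables (p : nat) (p_prime : prime p) (p_odd : odd p).
Variables (L : fieldExtType 'F_p(t)) (s u w : L) (L_R2 : is_R2 s u w).
Variables (F : finFieldType) (kappa : {rmorphism 'F_p -> F}).
Variables (a : 'F_p) (a_neq0 : a != 0) (a_neq1 : a != 1).
Hypothesis cardF : #|F| = (p ^ 4)%N.
Local Notation iota := (poly_in L).
Local Notation O := (int_closure iota).
Local Notation place := (place_hom iota (eval_at kappa a) fullv).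
Local Notation D := (points kappa a).

Lemma int_closureP (o : O) : integralOver iota (val o).
Proof. by have := valP o; rewrite unfold_in => /asboolP. Qed.

Lemma place_rmorphism phi : place phi ->
  exists h : {rmorphism O -> F}, forall o, h o = phi (val o).
Proof.
case=> phi_iota phiD phiM; pose h (o : O) := phi (val o).
have h_zmod : zmod_morphism h.
  move=> x y; apply: (addIr (h y)); rewrite subrK -phiD ?memvf //;
    try exact: int_closureP.
  by rewrite -[_ + _]/(val (x - y + y)) subrK.
have h_monoid : monoid_morphism h.
  split; last by move=> o o'; rewrite /h -phiM ?memvf //; apply: int_closureP.
  by rewrite /h -[val 1]/1 -(rmorph1 iota) phi_iota rmorph1.
pose hA := GRing.isZmodMorphism.Build _ _ h h_zmod.
pose hM := GRing.isMonoidMorphism.Build _ _ h h_monoid.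
pose hR : {rmorphism O -> F} := HB.pack h hA hM.
by exists hR.
Qed.

Definition point_of (phi : L -> F) : F * F * F := (phi s, phi u, phi w).

Lemma point_ofP phi : place phi -> point_of phi \in D.
Proof.
move=> phiP; rewrite inE /=; have [_ phiD phiM] := phiP.
have [[sI uI] wI] := (s_integral L_R2, u_integral L_R2, w_integral L_R2).
have sqr y : integralOver iota y -> phi y ^+ 2 = phi (y ^+ 2).
  by move=> yI; rewrite !expr2 phiM ?memvf.
rewrite !sqr // (place_s2 L_R2 phiP) (place_u2 L_R2 phiP).
by rewrite (place_w2 L_R2 phiP (memvf _)) !eqxx.
Qed.

Lemma place_frob phi : place phi -> place (fun x => phi x ^+ p).
Proof.
case=> phi_iota phiD phiM; split=> [f|x y xE yE xI yI|x y xE yE xI yI].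
- by rewrite phi_iota eval_atE kappaX_p.
- by rewrite phiD // (exprpD p_prime kappa).
- by rewrite phiM // exprMn.
Qed.

Lemma residue_homs : exists h : F * F * F -> {rmorphism O -> F},
  [/\ forall x, x \in D -> exists phi, [/\ place phi, point_of phi = x &
        forall o, h x o = phi (val o)],
      forall x y, x \in D -> y \in D -> fconnect (frob p) x y ->
        forall o, h x o = 0 <-> h y o = 0
    & forall x y, x \in D -> y \in D -> (forall o, h x o = 0 -> h y o = 0) ->
        fconnect (frob p) x y].
Proof.
have [h hP] : exists h : F * F * F -> {rmorphism O -> F}, forall x, x \in D ->
    exists phi, [/\ place phi, point_of phi = x & forall o, h x o = phi (val o)].
  have ex x : exists h : {rmorphism O -> F}, x \in D ->
      exists phi, [/\ place phi, point_of phi = x & forall o, h o = phi (val o)].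
    case: (boolP (x \in D)) => [xD|_]; last first.
      have [phi /place_rmorphism [h _]] : exists phi, place phi.
        have [b b2] := sqrt_alpha p_prime p_odd kappa a cardF.
        have [c c2] := sqrt_1alpha p_prime p_odd kappa a cardF.
        have [d d2] := sqrt_1root p_prime p_odd cardF b2.
        have [phi [phiP _ _ _]] := place_exists p_prime p_odd L_R2 a_neq0 a_neq1 b2 c2 d2.
        by exists phi.
      by exists h.
    move: (xD); rewrite inE => /and3P[/eqP b2 /eqP c2 /eqP d2].
    have [phi [phiP es eu ew]] := place_exists p_prime p_odd L_R2 a_neq0 a_neq1 b2 c2 d2.
    have [h hP] := place_rmorphism phiP; exists h => _; exists phi; split=> //.
    by rewrite /point_of es eu ew; case: (x) => [[]].
  by have [h hP] := choice ex; exists h.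
have h_frob x : x \in D -> forall o, h (frob p x) o = h x o ^+ p.
  move=> xD o; have [phi [phiP phix hphi]] := hP _ xD.
  have [psi [psiP psix hpsi]] := hP _ (frob_points p_prime xD).
  rewrite hphi hpsi; move: psix; rewrite -phix /point_of /frob /= => -[es eu ew].
  exact: (place_uniq p_prime p_odd L_R2 a_neq0 a_neq1 psiP (place_frob phiP)
    es eu ew (int_closureP o)).
have iterD x i : x \in D -> iter i (frob p) x \in D.
  by move=> xD; elim: i => //= i; apply: frob_points.
have h_iter x i o : x \in D -> h (iter i (frob p) x) o = h x o ^+ (p ^ i).
  move=> xD; elim: i => [|i IH] /=; first by rewrite expn0 expr1.
  by rewrite h_frob ?iterD // IH -exprM expnSr.
exists h; split=> // x y xD yD.
  move=> /iter_findex <- o; rewrite h_iter //; split=> [->|/eqP].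
    by rewrite expr0n expn_eq0 eqn0Ngt prime_gt0.
  by rewrite expf_eq0 => /andP[_ /eqP].
move=> /(same_kernel_frob p_prime kappa cardF) [i hi].
suff -> : y = iter i (frob p) x by apply: fconnect_iter.
have [phi [phiP phix hphi]] := hP _ (iterD x i xD).
have [psi [psiP psiy hpsi]] := hP _ yD.
have e (z : L) : integralOver iota z -> psi z = phi z.
  move=> zI; have zO : z \in integral_over_pred iota by rewrite unfold_in; apply/asboolP.
  by have := hi (IntClosure zO); rewrite -h_iter // hphi hpsi.
rewrite -psiy -phix /point_of !e //.
- exact: w_integral L_R2.
- exact: u_integral L_R2.
exact: s_integral L_R2.
Qed.

Local Open Scope classical_set_scope.

Lemma kernel_above (h : {rmorphism O -> F}) phi : place phi ->
  (forall o, h o = phi (val o)) ->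
  primes_above iota ('X - a%:P) [set o | h o = 0].
Proof.
move=> [phi_iota _ _] hE; split; last first.
  move=> f /=; rewrite hE /= phi_iota eval_atE; split=> [/eqP|[y ->]].
    by rewrite fmorph_eq0 => /factor_theorem [q ->]; exists q.
  by rewrite !hornerE subrr mulr0 rmorph0.
split.
  split; rewrite ?inE /=.
  - by rewrite rmorph0.
  - by apply/negP; rewrite inE /= rmorph1 => /eqP; rewrite oner_eq0.
  - by move=> b v v'; rewrite !inE /= rmorphD rmorphM => -> ->; rewrite mulr0 addr0.
move=> v v'; rewrite !inE /= rmorphM => /eqP; rewrite mulf_eq0 => /orP[] /eqP e.
  by apply/orP; left; rewrite inE.
by apply/orP; right; rewrite inE.
Qed.

Lemma above_kernel (h : F * F * F -> {rmorphism O -> F}) (P : set O) :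
    (forall x, x \in D -> exists phi, [/\ place phi, point_of phi = x &
        forall o, h x o = phi (val o)]) ->
    primes_above iota ('X - a%:P) P ->
  exists2 x, x \in D & P = [set o | h x o = 0].
Proof.
move=> hP [[[P0 P1 Plin] Pprime] Pa].
have PM o o' : P o -> P (o' * o).
  by move=> Po; rewrite -[_ * _]addr0; have := Plin o' o 0; rewrite !inE in P0 *; apply.
have PD o o' : P o -> P o' -> P (o + o').
  by move=> Po Po'; have := Plin 1 o o'; rewrite !inE mul1r; apply.
have nP1 : ~ P 1 by move: P1 => /negP; rewrite inE.
have Por o o' : P (o * o') -> P o \/ P o'.
  by move=> Poo; have := Pprime o o'; rewrite !inE => /(_ Poo) /orP[]; rewrite inE; tauto.
pose PL z := exists2 o : O, val o = z & P o.
have mkO z : integralOver iota z -> exists o : O, val o = z.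
  move=> zI; have zO : z \in integral_over_pred iota by rewrite unfold_in; apply/asboolP.
  by exists (IntClosure zO).
have PL_val o : PL (val o) -> P o by case=> o' /val_inj <-.
have sep := place_separate p_prime p_odd L_R2 a_neq0 a_neq1 (P := PL) _ _ _ _
  (sqrt_alpha p_prime p_odd kappa a cardF) (sqrt_1alpha p_prime p_odd kappa a cardF)
  (sqrt_1root p_prime p_odd cardF).
have {}sep o : (forall x, x \in D -> h x o = 0) -> P o.
  move=> ho; apply: (PL_val); apply: sep; last first.
  - move=> phi phiP; have [psi [psiP psix hpsi]] := hP _ (point_ofP phiP).
    rewrite -(ho _ (point_ofP phiP)) hpsi; case: psix => es eu ew.
    by rewrite (place_uniq p_prime p_odd L_R2 a_neq0 a_neq1 psiP phiP es eu ew (int_closureP o)).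
  - exact: int_closureP.
  - move=> f; split=> [[o' o'f Po']|fa].
      have : P (int_closure_in iota f) by apply: (PL_val); exists o'.
      by rewrite Pa => -[y ->]; rewrite !hornerE subrr mulr0.
    exists (int_closure_in iota f) => //; rewrite Pa.
    have /factor_theorem [q ->] : root f a by apply/eqP.
    by exists q.
  - move=> x z /mkO [ox <-] /mkO [oz <-] [o' o'E Po'].
    have /Por [] : P (ox * oz) by apply: (PL_val); exists o'.
      by left; exists ox.
    by right; exists oz.
  - move=> x z xI /mkO [oz <-] [ox <- Px]; exists (oz * ox); last exact: PM.
    by rewrite mulrC.
  by move=> x z xI zI [ox <- Px] [oz <- Pz]; exists (ox + oz) => //; apply: PD.
have [x xD sub] : exists2 x, x \in D & forall o, h x o = 0 -> P o.
  apply: contrapT => nsub.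
  have [y yP] : exists y : F * F * F -> O, forall x, x \in D -> h x (y x) = 0 /\ ~ P (y x).
    have ex x : exists o, x \in D -> h x o = 0 /\ ~ P o.
      apply: contrapT => nex; apply: nsub; have xD : x \in D.
        by apply: contrapT => nx; apply: nex; exists 0 => /nx.
      exists x => // o ho; apply: contrapT => nPo; apply: nex.
      by exists o.
    by have [y yP] := choice ex; exists y.
  have : P (\prod_(x in D) y x).
    apply: sep => x xD; rewrite rmorph_prod (bigD1 x) //=.
    by rewrite (proj1 (yP x xD)) mul0r.
  apply: (big_ind (fun o => ~ P o)) => // [o o' no no' /Por []//|x xD].
  exact: (proj2 (yP x xD)).
exists x => //; apply/seteqP; split=> [o Po /=|o /= /sub //].
apply: contrapT => /eqP ho; apply: nP1.
have -> : 1 = (1 - o ^+ #|F|.-1) + o ^+ #|F|.-1 by rewrite subrK.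
have F1 := card_finRing_gt1 F.
apply: PD.
  apply: sub; rewrite rmorphB rmorph1 rmorphXn.
  apply/eqP; rewrite subr_eq0; apply/eqP; apply: (mulIf ho).
  by rewrite mul1r -exprSr prednK ?expf_card // ltnW.
have -> : #|F|.-1 = #|F|.-2.+1 by rewrite prednK // -ltnS prednK // ltnW.
by rewrite exprSr; apply: PM.
Qed.

Lemma card_primes_above f n : (n * f)%N = 8%N ->
    {in D, forall x, fingraph.order (frob p) x = f} ->
  primes_above iota ('X - a%:P) #= `I_n.
Proof.
move=> nf ordf; have [h [hP h_conn h_ker]] := residue_homs.
pose B := [predI froots (frob p) & D].
have cardB : #|B| = n.
  have f0 : (0 < f)%N by case: f nf {ordf} => //; rewrite muln0.
  apply/eqP; rewrite -(eqn_pmul2r f0) nf -(card_points p_prime p_odd kappa a_neq0 a_neq1 cardF).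
  rewrite -(@fcard_order_set _ _ (frob_inj p_prime kappa) f (mem D)) //.
    by apply/fintype.subsetP => x xD; rewrite inE ordf.
  exact: frob_closed.
pose K (i : 'I_#|B|) : set O := [set o | h (enum_val i) o = 0].
have BD (i : 'I_#|B|) : enum_val i \in D by have := enum_valP i; rewrite inE => /andP[].
have K_inj : injective K.
  move=> i j Kij; apply: enum_val_inj.
  have conn : fconnect (frob p) (enum_val i) (enum_val j).
    by apply: h_ker => // o ho; have : K i o by []; rewrite Kij.
  have := enum_valP i; have := enum_valP j.
  rewrite !inE => /andP[/eqP rj _] /andP[/eqP ri _]; rewrite -ri -rj.
  exact: (fingraph.rootP (fconnect_sym (frob_inj p_prime kappa)) conn).
have -> : primes_above iota ('X - a%:P) = range K.
  apply/seteqP; split=> [P /(above_kernel hP) [x xD ->]|_ [i _ <-]]; last first.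
    by have [phi [phiP _ hphi]] := hP _ (BD i); apply: kernel_above phiP hphi.
  have rD : froot (frob p) x \in D.
    by rewrite -(closed_connect (frob_closed p_prime kappa a) (connect_root _ x)).
  have rB : froot (frob p) x \in B.
    by rewrite inE rD andbT; apply: roots_root; apply: fconnect_sym; apply: frob_inj kappa.
  exists (enum_rank_in rB (froot (frob p) x)) => //; rewrite /K enum_rankK_in //.
  by apply/seteqP; split=> o /=; rewrite (h_conn _ _ xD rD (connect_root _ x) o).
rewrite -cardB; apply: card_eq_trans (_ : [set: 'I_#|B|] #= _).
  by apply: inj_card_eq => i j _ _; apply: K_inj.
by rewrite card_eq_sym; apply: card_II.
Qed.

End Primes.

Theorem theorem1p2 (p : nat) (p_prime : prime p) (p_odd : odd p)
    (L : fieldExtType 'F_p(t)) (s u w : L) (L_R2 : is_R2 s u w)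
    (a : 'F_p) (a_neq0 : a != 0) (a_neq1 : a != 1) (a_neq_half : a != 2%:R^-1) :
  [/\ (A2 p).[a] = 1 ->
        primes_above (poly_in L) ('X - a%:P) #= `I_8,
      (A2 p).[a] = -1 \/ (A2 p).[a] = 0 \/ (A2 p).[a] ^+ 2 = 1 / (1 - a) ->
        primes_above (poly_in L) ('X - a%:P) #= `I_4
    & (A2 p).[a] ^+ 2 = a / (1 - a) ->
        primes_above (poly_in L) ('X - a%:P) #= `I_2].
Proof.
have [F pcharF cardF] := pPrimePowerField p_prime (isT : 0 < 4)%N.
pose kappa0 : {rmorphism 'F_p -> pPrimeCharType pcharF} := in_alg _.
pose kappa : {rmorphism 'F_p -> F} := kappa0.
have a1 : 1 - a != 0 by rewrite subr_eq0 eq_sym.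
have kdiv x y : x = y / (1 - a) -> kappa x * (1 - kappa a) = kappa y.
  by move=> ->; rewrite -(rmorph1 kappa) -rmorphB -rmorphM divfK.
have count := card_primes_above p_prime p_odd L_R2 (kappa := kappa) a_neq0 a_neq1 cardF.
have finj := frob_inj p_prime kappa.
split=> A1.
- apply: (count 1%N 8%N) => // x xD; apply: order_eq1.
  apply: (frob_order1 p_prime p_odd a_neq0 a_neq1 a_neq_half xD).
  by rewrite A1 rmorph1.
- apply: (count 2%N 4%N) => // x xD.
  have [] := frob_order2 p_prime p_odd a_neq0 a_neq1 a_neq_half xD.
    case: A1 => [->|[->|/kdiv e]]; rewrite ?rmorphN ?rmorph1 ?rmorph0; [by left|by right; left|].
    by right; right; rewrite -rmorphXn e rmorph1.
  exact: order_eq2.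
apply: (count 4%N 2%N) => // x xD.
have [] := frob_order4 p_prime p_odd a_neq0 a_neq1 a_neq_half xD.
  by rewrite -rmorphXn; apply: kdiv.
exact: order_eq4.
Qed.
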